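(* Let $\mathcal{C}=(\Omega,V)$ be a locally recoverable fractional repetition code with parameters $(n,\theta,\alpha,\rho)$ in which each node belongs to a local FR code with parameters $(n_{loc},\theta_{loc},\alpha,\rho_{loc})$. Suppose that the file size $\mathcal{M}$ satisfies $\mathcal{M}>\theta_{loc}$. Then the minimum distance satisfies $$d_{\min} \le \max\left( n-\left\lceil \frac{\mathcal{M}\rho_{loc}}{\alpha}\right\rceil+\rho_{loc},\; n+n_{loc}+1-\left\lceil \frac{\mathcal{M}\rho_{loc}+\theta_{loc}}{\alpha}\right\rceil\right).$$
   Context: Recoverability: for subsets $V_1,\dots,V_d$ of $\Omega$ and $A\subset\Omega$ with $|A|=d\beta$, $A$ is $\beta$-recoverable from $\{V_1,\dots,V_d\}$ if there are $B_i\subseteq V_i$ with $B_i\subset A$, $|B_i|=\beta$ for each $i$, and $\bigcup_{i=1}^d B_i=A$. A fractional repetition (FR) code $\mathcal{C}=(\Omega,V)$ with parameters $(n,\theta,\alpha,\rho)$ is a collection $V=\{V_1,\dots,V_n\}$ of $n$ distinct subsets (storage nodes) of a symbol set $\Omega$ with $|\Omega|=\theta$ such that (a) $|V_i|=\alpha$ for all $i$; (b) each element of $\Omega$ belongs to exactly $\rho$ of the sets in $V$; (c) with repair degree $d$, $\beta=\alpha/d$ a positive integer, and resilience parameter $\rho^{res}\le\rho$: for any $(n-\rho^{res}+1)$-sized $V^{surv}\subseteq V$, each node in $V\setminus V^{surv}$ is $\beta$-recoverable from some $d$-sized subset of $V^{surv}$. In particular $n\alpha=\theta\rho$. Let $k$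 be the number of nodes contacted for recovering the file and $r$ the local repair degree, $r<k$, $r\le d$. A node $V_i$ is locally recoverable if there is a set $W_i\subset V$ (a local structure) with $V_i\in W_i$ such that $V_i$ is $\alpha/r$-recoverable from ($r$ nodes of) $W_i\setminus\{V_i\}$; the code is locally recoverable if every node belongs to at least one local structure. A local structure $W\subset V$ that is itself an FR code on the symbol set $\bigcup_{X\in W}X$ is called a local FR code; it has parameters $(n_{loc},\theta_{loc},\alpha,\rho_{loc})$ if it has $n_{loc}$ nodes, $\theta_{loc}$ symbols, and each of its symbols is contained in exactly $\rho_{loc}$ of its nodes. A file of $\mathcal{M}\le\theta$ symbols is encoded by a $(\theta,\mathcal{M})$-MDS code and the $\theta$ encoded symbols are placed on the nodes according to $\mathcal{C}$; a set of nodes can recover the file if and only if its union contains at least $\mathcal{M}$ distinct symbols. The minimum distance $d_{\min}$ (for file size $\mathcal{M}$) is the smallest size of a set of nodes whose failure makes the file not recoverable from the surviving nodes, i.e. the smallest $|F|$ over $F\subseteq V$ such that the nodes in $V\setminus F$ together contain fewer than $\mathcal{M}$ distinct symbols. *)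

(* Defs.v *)
From mathcomp Require Import all_boot all_order all_algebra.

Set Implicit Arguments.
Unset Strict Implicit.
Unset Printing Implicit Defensive.

(* A code C = (Omega, V) lives in an ambient finite type T:
   the symbol set is Omega : {set T}, and V : {set {set T}} is a set of nodes,
   so the nodes are automatically distinct. [cover U] is the union of the
   nodes in U. *)

(* The sets V_1, ..., V_d from which A is recovered are the d members of U;
   B X is the part of A read from the node X. *)
Definition recoverable (T : finType) (beta : nat) (A : {set T})
    (U : {set {set T}}) : Prop :=
  #|A| = #|U| * beta /\
  exists B : {set T} -> {set T},
    [/\ forall X, X \in U -> B X \subset X,
        forall X, X \in U -> B X \subset A,
        forall X, X \in U -> #|B X| = beta
      & \bigcup_(X in U) B X = A].

(* rres is the resilience parameter. The subtraction n - rres does not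
   truncate: the other clauses give rres <= rho <= n. *)
Record FR_code (T : finType) (Omega : {set T}) (V : {set {set T}})
    (n theta alpha rho d beta rres : nat) : Prop := FRCode {
  FR_nodes : forall X, X \in V -> X \subset Omega;
  FR_n_gt0 : 0 < n;
  FR_n : #|V| = n;
  FR_theta : #|Omega| = theta;
  FR_alpha : forall X, X \in V -> #|X| = alpha;
  FR_rho : forall x, x \in Omega -> #|[set X in V | x \in X]| = rho;
  FR_d_gt0 : 0 < d;
  FR_beta_gt0 : 0 < beta;
  FR_beta : alpha = d * beta;
  FR_rres : rres <= rho;
  FR_repair : forall Vsurv : {set {set T}},
    Vsurv \subset V -> #|Vsurv| = n - rres + 1 ->
    forall A, A \in V :\: Vsurv ->
    exists U : {set {set T}},
      [/\ U \subset Vsurv, #|U| = d & recoverable beta A U]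
}.

Definition local_structure (T : finType) (V : {set {set T}}) (alpha r : nat)
    (A : {set T}) (W : {set {set T}}) : Prop :=
  [/\ W \subset V, A \in W, r %| alpha
    & exists U : {set {set T}},
        [/\ U \subset W :\ A, #|U| = r & recoverable (alpha %/ r) A U]].

Definition locally_recoverable (T : finType) (V : {set {set T}})
    (alpha r : nat) : Prop :=
  forall A, A \in V -> exists W, local_structure V alpha r A W.

(* The repair degree and the resilience of a local FR code are not among its
   four parameters, and are left free. *)
Definition local_FR_code (T : finType) (V : {set {set T}}) (alpha r : nat)
    (A : {set T}) (W : {set {set T}}) (nloc thetaloc rholoc : nat) : Prop :=
  local_structure V alpha r A W /\
  exists dloc betaloc rresloc : nat,
    FR_code (cover W) W nloc thetaloc alpha rholoc dloc betaloc rresloc.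

(* The MDS property of the outer code enters only through this criterion. *)
Definition can_recover (T : finType) (M : nat) (U : {set {set T}}) : bool :=
  M <= #|cover U|.

Definition fatal (T : finType) (V : {set {set T}}) (M : nat)
    (F : {set {set T}}) : bool :=
  (F \subset V) && ~~ can_recover M (V :\: F).

(* For 0 < M, the failure of all of V is fatal, so the minimum is taken over a
   nonempty collection; see min_distanceP. *)
Definition min_distance (T : finType) (V : {set {set T}}) (M : nat) : nat :=
  #|[arg min_(F < V | fatal V M F) #|F|]|.

Lemma min_distanceP (T : finType) (V : {set {set T}}) (M : nat) :
  0 < M ->
  (exists2 F, fatal V M F & #|F| = min_distance V M) /\
  (forall F, fatal V M F -> min_distance V M <= #|F|).
Proof.
move=> M_gt0; rewrite /min_distance; case: arg_minnP => [|F failF minF].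
  by rewrite /fatal subxx setDv /can_recover /cover big_set0 cards0 -ltnNge.
by split=> //; exists F.
Qed.

(* Main.v *)
Require Import Defs.
From mathcomp Require Import all_boot all_order all_algebra.
From mathcomp Require Import zify.

(** Let s = M - |cover S|, where S is a largest set of nodes that covers fewer
    than M symbols and satisfies rholoc * |cover S| <= alpha * |S|. Joining S
    with a local FR code W preserves the second condition, because all rholoc
    nodes of W that contain a new symbol are themselves new. So for a W that
    meets the complement of S the union covers at least M symbols, whence
    s <= thetaloc. Let U be a largest set between S and S :|: W that covers
    fewer than M symbols; one more node brings the cover up to M, whence
    s <= alpha * (|U| - |S| + 1). Together with
    rholoc * thetaloc <= alpha * nloc, these bounds give
    M * rholoc + thetaloc <= alpha * (|U| + nloc + 1),
    and the failure of all nodes outside U is fatal. The second term of the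
    maximum is thus always an upper bound. *)

(** Count the pairs of a symbol [x] in [X] and a node of [W] containing it: each symbol occurs in at
    least [rho] pairs, each node in at most [alpha]. Inequalities suffice, so the bound applies to a
    whole local code, to the new part of one, and with [rho = 1] to any cover. *)
Lemma double_count_leq (T : finType) (W : {set {set T}}) (X : {set T})
    (alpha rho : nat) :
  (forall A, A \in W -> #|A| <= alpha) ->
  (forall x, x \in X -> rho <= #|[set A in W | x \in A]|) ->
  rho * #|X| <= alpha * #|W|.
Proof.
move=> cardW degX.
rewrite mulnC -sum_nat_const (leq_trans (leq_sum _ degX)) //.
under eq_bigr => x _ do rewrite -sum1dep_card.
rewrite (exchange_big_dep (mem W)) /= => [|x A _ /andP[]//].
rewrite mulnC -sum_nat_const; apply: leq_sum => A AW.
apply: leq_trans (cardW A AW); rewrite sum1dep_card; apply: subset_leq_card.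
by apply/subsetP => x; rewrite inE => /andP[_ /andP[]].
Qed.

Lemma coverU (T : finType) (U W : {set {set T}}) :
  cover (U :|: W) = cover U :|: cover W.
Proof. exact: bigcup_setU. Qed.

Lemma coverS (T : finType) (U W : {set {set T}}) :
  U \subset W -> cover U \subset cover W.
Proof. by move=> sUW; rewrite -(setUidPr sUW) coverU subsetUl. Qed.

Lemma card_cover_leq (T : finType) (U : {set {set T}}) (alpha : nat) :
  (forall A, A \in U -> #|A| <= alpha) -> #|cover U| <= alpha * #|U|.
Proof.
move=> cardU; rewrite -[#|cover U|]mul1n; apply: double_count_leq => // x.
case/bigcupP=> A AU xA; rewrite card_gt0; apply/set0Pn; exists A.
by rewrite inE AU.
Qed.

Lemma leq_card_coverU (T : finType) (S W : {set {set T}}) (alpha rho : nat) :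
  (forall A, A \in W -> #|A| <= alpha) ->
  (forall x, x \in cover W -> #|[set A in W | x \in A]| = rho) ->
  rho * #|cover S| <= alpha * #|S| ->
  rho * #|cover (S :|: W)| <= alpha * #|S :|: W|.
Proof.
move=> cardW degW leS.
have leD : rho * #|cover W :\: cover S| <= alpha * #|W :\: S|.
  apply: double_count_leq => [A /setDP[AW _]|x]; first exact: cardW.
  case/setDP=> xW xS; rewrite -(degW x xW); apply: subset_leq_card.
  apply/subsetP => A; rewrite !inE => /andP[AW xA]; rewrite AW xA !andbT.
  by apply: contra xS => AS; apply/bigcupP; exists A.
have cardUD (I : finType) (A B : {set I}) : #|A :|: B| = #|A| + #|B :\: A|.
  by rewrite cardsU setIC -addnBA ?subset_leq_card ?subsetIl // cardsD.
by rewrite coverU !cardUD !mulnDr leq_add.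
Qed.

Lemma ex_large_unrecoverable (T : finType) (V : {set {set T}})
    (alpha nloc thetaloc rholoc M : nat) :
  0 < M -> 0 < rholoc -> M <= #|cover V| ->
  (forall A, A \in V -> #|A| = alpha) ->
  (forall A, A \in V -> exists W : {set {set T}},
     [/\ W \subset V, A \in W, #|W| = nloc, #|cover W| = thetaloc
       & forall x, x \in cover W -> #|[set B in W | x \in B]| = rholoc]) ->
  exists2 U : {set {set T}}, (U \subset V) && (#|cover U| < M)
    & M * rholoc + thetaloc <= alpha * (#|U| + nloc + 1).
Proof.
move=> M_gt0 rho_gt0 leMV cardV locV.
pose good (S : {set {set T}}) :=
  [&& S \subset V, #|cover S| < M & rholoc * #|cover S| <= alpha * #|S|].
have good0 : good set0.
  by rewrite /good sub0set /cover big_set0 !cards0 M_gt0 !muln0.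
have [S /and3P[sSV ltSM leS] maxS] :=
  arg_maxnP (fun S : {set {set T}} => #|S|) good0.
have [A AV AnS] : exists2 A, A \in V & A \notin S.
  apply/subsetPn; apply: contraL ltSM => /coverS/subset_leq_card sVS.
  by rewrite -leqNgt (leq_trans leMV).
have [W [sWV AW cardW coverW degW]] := locV A AV.
have leA (U : {set {set T}}) : U \subset V -> forall B, B \in U -> #|B| <= alpha.
  by move=> /subsetP sUV B /sUV/cardV->.
have leMSW : M <= #|cover (S :|: W)|.
  rewrite leqNgt; apply/negP => ltSWM.
  have /maxS/= : good (S :|: W).
    rewrite /good subUset sSV sWV ltSWM.
    exact: leq_card_coverU (leA W sWV) degW leS.
  rewrite leqNgt proper_card // properE subsetUl /=.
  by apply/subsetPn; exists A; rewrite // inE AW orbT.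
pose between (U : {set {set T}}) :=
  [&& S \subset U, U \subset S :|: W & #|cover U| < M].
have betweenS : between S by rewrite /between subxx subsetUl.
have [U /and3P[sSU sUSW ltUM] maxU] :=
  arg_maxnP (fun U : {set {set T}} => #|U|) betweenS.
have [Z ZSW ZnU] : exists2 Z, Z \in S :|: W & Z \notin U.
  apply/subsetPn; apply: contraL ltUM => /coverS/subset_leq_card le_SW.
  by rewrite -leqNgt (leq_trans leMSW).
have sSWV : S :|: W \subset V by rewrite subUset sSV.
have sUV := subset_trans sUSW sSWV.
have sZUSW : Z |: U \subset S :|: W by rewrite subUset sub1set ZSW.
have leMZU : M <= #|cover (Z |: U)|.
  rewrite leqNgt; apply/negP => ltZUM.
  have /maxU/= : between (Z |: U).
    by rewrite /between (subset_trans sSU) ?subsetUr // sZUSW.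
  by rewrite cardsU1 ZnU ltnn.
exists U; first by rewrite sUV.
have sSZU : S \subset Z |: U by rewrite (subset_trans sSU) ?subsetUr.
have cardSU : #|(Z |: U) :\: S| + #|S| = #|U|.+1.
  rewrite cardsD (setIidPr sSZU) subnK ?subset_leq_card //.
  by rewrite cardsU1 ZnU.
(* Each node added to [S] brings at most [alpha] new symbols. *)
have leZU : #|cover (Z |: U)| <= #|cover S| + alpha * #|(Z |: U) :\: S|.
  have -> : cover (Z |: U) = cover S :|: cover ((Z |: U) :\: S).
    by rewrite -coverU setDE setUIr setUCr setIT (setUidPr sSZU).
  rewrite (leq_trans (leq_card_setU _ _)) // leq_add2l card_cover_leq //.
  apply: leA; apply: subset_trans (subsetDl _ _) _; exact: subset_trans sSWV.
have leSW : #|cover (S :|: W)| <= #|cover S| + thetaloc.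
  by rewrite coverU -coverW leq_card_setU.
have leW : rholoc * thetaloc <= alpha * nloc.
  rewrite -coverW -cardW; apply: double_count_leq (leA W sWV) _ => x xW.
  by rewrite degW.
have leMS : M - #|cover S| <= thetaloc.
  by rewrite leq_subLR (leq_trans leMSW).
have leMD : M - #|cover S| <= alpha * #|(Z |: U) :\: S|.
  by rewrite leq_subLR (leq_trans leMZU).
have -> : #|U| + nloc + 1 = #|S| + #|(Z |: U) :\: S| + nloc.
  by rewrite addn1 -addSn -cardSU [#|S| + _]addnC.
(* With s = [M - #|cover S|], split [M * rholoc] as [rholoc * #|cover S|] + s + ([rholoc] - 1) s.
   Since s is at most [thetaloc], the last summand plus [thetaloc] is at most
   [rholoc * thetaloc]. *)
have leM : M * rholoc + thetaloc
    <= rholoc * #|cover S| + (M - #|cover S|) + rholoc * thetaloc.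
  rewrite -{1}(subnKC (ltnW ltSM)) mulnC mulnDr -!addnA leq_add2l.
  rewrite -(prednK rho_gt0) !mulSn addnAC -addnA leq_add2l leq_add2l.
  by rewrite leq_mul2l leMS orbT.
(* The three summands are bounded by [leS], [leMD] and [leW] respectively. *)
by rewrite (leq_trans leM) // !mulnDr !leq_add.
Qed.

Theorem lemma4 (T : finType) (Omega : {set T}) (V : {set {set T}})
    (n theta alpha rho d beta rres : nat)
    (k r : nat) (nloc thetaloc rholoc : nat) (M : nat)
    (HC : FR_code Omega V n theta alpha rho d beta rres)
    (Hr0 : 0 < r) (Hrk : r < k) (Hrd : r <= d)
    (HM : M <= theta)
    (Hkn : k <= n)
    (Hk : forall U : {set {set T}}, U \subset V -> #|U| = k -> can_recover M U)
    (Hlr : locally_recoverable V alpha r)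
    (Hloc : forall A, A \in V ->
      exists W, local_FR_code V alpha r A W nloc thetaloc rholoc)
    (HMloc : thetaloc < M) :
  ((min_distance V M)%:Z <=
     Num.max
       (n%:Z - Num.ceil ((M * rholoc)%N%:R / alpha%:R : rat) + rholoc%:Z)
       (n%:Z + nloc%:Z + 1
          - Num.ceil ((M * rholoc + thetaloc)%N%:R / alpha%:R : rat)))%R.
Proof.
have M_gt0 : 0 < M by apply: leq_trans HMloc.
have alpha_gt0 : 0 < alpha.
  by rewrite (FR_beta HC) muln_gt0 (FR_d_gt0 HC) (FR_beta_gt0 HC).
(* As [k <= n], some [k] nodes exist, and they already recover the file. *)
have leMV : M <= #|cover V|.
  have [U [sUV cardU]] : exists U : {set {set T}}, U \subset V /\ #|U| = k.
    have : 0 < #|[set U : {set {set T}} | U \subset V & #|U| == k]|.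
      by rewrite cards_draws bin_gt0 (FR_n HC).
    by rewrite card_gt0 => /set0Pn[U]; rewrite inE => /andP[sUV /eqP]; exists U.
  exact: leq_trans (Hk _ sUV cardU) (subset_leq_card (coverS _ _ _ sUV)).
(* A node is nonempty, and any symbol of it lies in at least that node of its local code. *)
have rholoc_gt0 : 0 < rholoc.
  have /card_gt0P[A AV] : 0 < #|V| by rewrite (FR_n HC) (FR_n_gt0 HC).
  have [W [[_ AW _ _] [dl [bl [rl HW]]]]] := Hloc A AV.
  have /card_gt0P[x xA] : 0 < #|A| by rewrite (FR_alpha HC AV).
  have xW : x \in cover W by apply/bigcupP; exists A.
  rewrite -(FR_rho HW xW) card_gt0; apply/set0Pn; exists A.
  by rewrite inE AW.
have [|U /andP[sUV ltUM] leU] :=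
    ex_large_unrecoverable _ V alpha nloc thetaloc rholoc M
      M_gt0 rholoc_gt0 leMV (fun A => @FR_alpha _ _ _ _ _ _ _ _ _ _ HC A).
  move=> A /Hloc[W [[sWV AW _ _] [dl [bl [rl HW]]]]]; exists W.
  by split=> //; [exact: FR_n HW | exact: FR_theta HW | exact: FR_rho HW].
(* When [V :\: U] fails, exactly [U] survives. *)
have le_min : min_distance V M + #|U| <= n.
  have /(proj2 (min_distanceP V M_gt0)) : fatal V M (V :\: U).
    by rewrite /fatal subsetDl setDDr setDv set0U (setIidPr sUV)
      /can_recover -ltnNge.
  rewrite cardsD (setIidPr sUV) -(FR_n HC).
  by rewrite leq_subRL ?subset_leq_card // addnC.
rewrite Order.TotalTheory.le_max; apply/orP; right.
(* An integer bounds the ceiling as soon as it bounds the quotient, so [leU] only has to be divided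
   by [alpha]. *)
have leceil : (Num.ceil ((M * rholoc + thetaloc)%N%:R / alpha%:R : rat)
    <= (#|U| + nloc + 1)%N%:Z)%R.
  rewrite Num.Theory.ceil_le_int Num.Theory.ler_pdivrMr ?Num.Theory.ltr0n //.
  by rewrite -GRing.natrM Num.Theory.ler_nat [leqRHS]mulnC.
by clear -le_min leceil; lia.
Qed.
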